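(* Let $\mathcal{C}$ be a Mal'tsev category such that, for every object $X$ of $\mathcal{C}$, the category $\mathsf{Pt}_X(\mathcal{C})$ is algebraically coherent. Then the full subcategory $\mathsf{GS}(\mathcal{C})$ of $\mathcal{C}$ determined by the objects with global support is protomodular. In particular, if every object of $\mathcal{C}$ admits a pullback-stable strong epimorphism to the terminal object, then $\mathcal{C}$ is protomodular.
   Context: A Mal'tsev category is a finitely complete category in which every (internal) reflexive relation is an equivalence relation. An object $D$ of a category with terminal object $1$ has global support if the unique morphism $D\to 1$ is a pullback-stable strong epimorphism (a strong epimorphism all of whose pullbacks are strong epimorphisms). $\mathsf{Pt}_X(\mathcal{C})$ is the category of points over $X$: objects are triples $(A,\ p\colon A\to X,\ s\colon X\to A)$ with $ps=1_X$, and morphisms are morphisms between the objects $A$ commuting with the $p$'s and the $s$'s. For $f\colon X\to Y$, the change-of-base functor $f^*\colon \mathsf{Pt}_Y(\mathcal{C})\to\mathsf{Pt}_X(\mathcal{C})$ is pulling back along $f$. A category is protomodular if it has pullbacks of split epimorphisms along any map and for every morphism $f$ the functor $f^*$ between categories of points reflects isomorphisms. A cospan $(f\colon X\to Z,\ g\colon Y\to Z)$ in a category with finite limits is jointly strongly epimorphic if every monomorphism into $Z$ through which both $f$ and $g$ factor is an isomorphism. A functor between categories with finite limits is coherent if it preserves finite limits and jointly strongly epimorphic pairs. A category $\mathcal{D}$ with finite limits is algebraically coherent if $f^*\colon\mathsf{Pt}_Y(\mathcal{D})\to\mathsf{Pt}_X(\mathcal{D})$ is coherent for every morphism $f\colon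 X\to Y$ of $\mathcal{D}$. *)

(* Defs.v *)
From Stdlib Require Import List FinFun ProofIrrelevance.

Set Implicit Arguments.
Unset Strict Implicit.
Unset Printing Implicit Defensive.

(** * Categories and functors *)

(** Morphisms are compared by Leibniz equality; [comp g f] is [g] after [f]. *)
Record Category : Type := {
  Ob :> Type;
  Hom : Ob -> Ob -> Type;
  idm : forall X, Hom X X;
  comp : forall X Y Z, Hom Y Z -> Hom X Y -> Hom X Z;
  comp_idl : forall X Y (f : Hom X Y), comp (idm Y) f = f;
  comp_idr : forall X Y (f : Hom X Y), comp f (idm X) = f;
  comp_assoc : forall X Y Z W (h : Hom Z W) (g : Hom Y Z) (f : Hom X Y),
      comp h (comp g f) = comp (comp h g) f
}.

Arguments Hom {c} _ _.
Arguments idm {c} X.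
Arguments comp {c X Y Z} _ _.

Declare Scope cat_scope.
Delimit Scope cat_scope with cat.
Notation "g ∘ f" := (comp g f) (at level 40, left associativity) : cat_scope.
Local Open Scope cat_scope.

Record Functor (C D : Category) : Type := {
  fob :> C -> D;
  fmap : forall X Y : C, Hom X Y -> Hom (fob X) (fob Y);
  fmap_id : forall X : C, fmap (idm X) = idm (fob X);
  fmap_comp : forall (X Y Z : C) (g : Hom Y Z) (f : Hom X Y),
      fmap (g ∘ f) = fmap g ∘ fmap f
}.

Arguments fmap {C D} _ {X Y} _.

Definition compF (C D E : Category) (G : Functor D E) (F : Functor C D) :
  Functor C E.
Proof.
refine {| fob := fun X => G (F X); fmap := fun X Y f => fmap G (fmap F f) |}.
- intros X; rewrite fmap_id; apply fmap_id.
- intros X Y Z g f; rewrite fmap_comp; apply fmap_comp.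
Defined.

Definition full_subcategory (C : Category) (P : C -> Prop) : Category := {|
  Ob := {X : C | P X};
  Hom := fun X Y => Hom (proj1_sig X) (proj1_sig Y);
  idm := fun X => idm (proj1_sig X);
  comp := fun X Y Z g f => g ∘ f;
  comp_idl := fun X Y f => comp_idl f;
  comp_idr := fun X Y f => comp_idr f;
  comp_assoc := fun X Y Z W h g f => comp_assoc h g f
|}.

(** * Classes of morphisms *)

Definition mono (C : Category) (X Y : C) (m : Hom X Y) : Prop :=
  forall (T : C) (a b : Hom T X), m ∘ a = m ∘ b -> a = b.

Definition epi (C : Category) (X Y : C) (e : Hom X Y) : Prop :=
  forall (T : C) (a b : Hom Y T), a ∘ e = b ∘ e -> a = b.

Definition iso (C : Category) (X Y : C) (f : Hom X Y) : Prop :=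
  exists g : Hom Y X, g ∘ f = idm X /\ f ∘ g = idm Y.

Definition split_epi (C : Category) (X Y : C) (p : Hom X Y) : Prop :=
  exists s : Hom Y X, p ∘ s = idm Y.

Definition strong_epi (C : Category) (X Y : C) (e : Hom X Y) : Prop :=
  epi e /\
  forall (M Z : C) (m : Hom M Z) (u : Hom X M) (v : Hom Y Z),
    mono m -> m ∘ u = v ∘ e ->
    exists d : Hom Y M, d ∘ e = u /\ m ∘ d = v.

Definition jointly_strongly_epi (C : Category) (X Y Z : C)
    (f : Hom X Z) (g : Hom Y Z) : Prop :=
  forall (M : C) (m : Hom M Z), mono m ->
    (exists f' : Hom X M, m ∘ f' = f) ->
    (exists g' : Hom Y M, m ∘ g' = g) ->
    iso m.

Definition reflects_isos (C D : Category) (F : Functor C D) : Prop :=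
  forall (X Y : C) (f : Hom X Y), iso (fmap F f) -> iso f.

(** * Limits *)

(** A pullback square over the cospan [(f, g)], with its universal property
    given as an operation. *)
Record Pullback (C : Category) (X Y Z : C) (f : Hom X Z) (g : Hom Y Z)
    : Type := {
  pb_ob : C;
  pb_fst : Hom pb_ob X;
  pb_snd : Hom pb_ob Y;
  pb_square : f ∘ pb_fst = g ∘ pb_snd;
  pb_lift : forall (T : C) (a : Hom T X) (b : Hom T Y),
      f ∘ a = g ∘ b -> Hom T pb_ob;
  pb_lift_fst : forall (T : C) (a : Hom T X) (b : Hom T Y)
      (e : f ∘ a = g ∘ b), pb_fst ∘ pb_lift e = a;
  pb_lift_snd : forall (T : C) (a : Hom T X) (b : Hom T Y)
      (e : f ∘ a = g ∘ b), pb_snd ∘ pb_lift e = b;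
  pb_unique : forall (T : C) (u v : Hom T pb_ob),
      pb_fst ∘ u = pb_fst ∘ v -> pb_snd ∘ u = pb_snd ∘ v -> u = v
}.

Record Cone (J C : Category) (F : Functor J C) : Type := {
  apex : C;
  leg : forall j : J, Hom apex (F j);
  leg_natural : forall (i j : J) (a : Hom i j), fmap F a ∘ leg i = leg j
}.

Arguments leg {J C F} _ _.

Definition is_limit (J C : Category) (F : Functor J C) (L : Cone F) : Prop :=
  forall K : Cone F,
    exists! u : Hom (apex K) (apex L), forall j : J, leg L j ∘ u = leg K j.

Definition map_cone (J C D : Category) (G : Functor C D) (F : Functor J C)
  (L : Cone F) : Cone (compF G F).
Proof.
refine (@Build_Cone _ _ (compF G F) (G (apex L)) (fun j => fmap G (leg L j)) _).
intros i j a; cbn; rewrite <- fmap_comp, leg_natural; reflexivity.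
Defined.

Definition finite_category (J : Category) : Prop :=
  Finite J /\ forall i j : J, Finite (Hom i j).

Definition finitely_complete (C : Category) : Prop :=
  forall (J : Category) (F : Functor J C), finite_category J ->
    exists L : Cone F, is_limit L.

Definition preserves_finite_limits (C D : Category) (G : Functor C D) : Prop :=
  forall (J : Category) (F : Functor J C) (L : Cone F), finite_category J ->
    is_limit L -> is_limit (map_cone G L).

Definition is_terminal (C : Category) (T : C) : Prop :=
  forall X : C, exists! t : Hom X T, True.

(** * Global support *)

Definition pullback_stable_strong_epi (C : Category) (X Y : C) (e : Hom X Y)
    : Prop :=
  strong_epi e /\
  forall (Z : C) (g : Hom Z Y) (pb : Pullback e g), strong_epi (pb_snd pb).

Definition global_support (C : Category) (D : C) : Prop :=
  exists (T : C) (t : Hom D T), is_terminal T /\ pullback_stable_strong_epi t.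

Definition GS (C : Category) : Category :=
  full_subcategory (@global_support C).

(** * Mal'tsev categories *)

(** An internal relation on [X] is a jointly monic pair [d0, d1 : R -> X]. *)
Section Relations.
Variables (C : Category) (R X : C) (d0 d1 : Hom R X).

Definition internal_relation : Prop :=
  forall (T : C) (a b : Hom T R), d0 ∘ a = d0 ∘ b -> d1 ∘ a = d1 ∘ b -> a = b.

Definition rel_reflexive : Prop :=
  exists r : Hom X R, d0 ∘ r = idm X /\ d1 ∘ r = idm X.

Definition rel_symmetric : Prop :=
  exists s : Hom R R, d0 ∘ s = d1 /\ d1 ∘ s = d0.

Definition rel_transitive : Prop :=
  forall pb : Pullback d1 d0,
    exists t : Hom (pb_ob pb) R,
      d0 ∘ t = d0 ∘ pb_fst pb /\ d1 ∘ t = d1 ∘ pb_snd pb.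

Definition rel_equivalence : Prop :=
  rel_reflexive /\ rel_symmetric /\ rel_transitive.

End Relations.

Definition maltsev (C : Category) : Prop :=
  finitely_complete C /\
  forall (R X : C) (d0 d1 : Hom R X),
    internal_relation d0 d1 -> rel_reflexive d0 d1 -> rel_equivalence d0 d1.

(** * Points *)

Record Point (C : Category) (X : C) : Type := {
  pt_ob : C;
  pt_proj : Hom pt_ob X;
  pt_sect : Hom X pt_ob;
  pt_split : pt_proj ∘ pt_sect = idm X
}.

Record PointHom (C : Category) (X : C) (P Q : Point X) : Type := {
  pt_map : Hom (pt_ob P) (pt_ob Q);
  pt_map_proj : pt_proj Q ∘ pt_map = pt_proj P;
  pt_map_sect : pt_map ∘ pt_sect P = pt_sect Q
}.

Lemma PointHom_eq (C : Category) (X : C) (P Q : Point X) (u v : PointHom P Q) :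
  pt_map u = pt_map v -> u = v.
Proof.
destruct u as [u pu su], v as [v pv sv]; cbn; intros e; destruct e.
f_equal; apply proof_irrelevance.
Qed.

Definition PointHom_id (C : Category) (X : C) (P : Point X) : PointHom P P :=
  {| pt_map := idm (pt_ob P);
     pt_map_proj := comp_idr (pt_proj P);
     pt_map_sect := comp_idl (pt_sect P) |}.

Definition PointHom_comp (C : Category) (X : C) (P Q S : Point X)
  (v : PointHom Q S) (u : PointHom P Q) : PointHom P S.
Proof.
refine {| pt_map := pt_map v ∘ pt_map u |}.
- rewrite comp_assoc, pt_map_proj; apply pt_map_proj.
- rewrite <- comp_assoc, pt_map_sect; apply pt_map_sect.
Defined.

Definition Pt (C : Category) (X : C) : Category.
Proof.
refine {| Ob := Point X;
          Hom := @PointHom C X;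
          idm := @PointHom_id C X;
          comp := @PointHom_comp C X |}.
- intros P Q u; apply PointHom_eq, comp_idl.
- intros P Q u; apply PointHom_eq, comp_idr.
- intros P Q S T w v u; apply PointHom_eq, comp_assoc.
Defined.

(** * Change of base *)

(** The functor [f^*] depends, up to natural isomorphism only, on a choice of
    the pullbacks along [f] of the points over [Y]. *)
Section ChangeOfBase.
Variables (C : Category) (X Y : C) (f : Hom X Y).

Definition pullback_choice : Type :=
  forall P : Pt Y, Pullback (pt_proj P) f.

Variable pb : pullback_choice.

Lemma base_change_sect_square (P : Pt Y) :
  pt_proj P ∘ (pt_sect P ∘ f) = f ∘ idm X.
Proof.
rewrite comp_assoc, pt_split, comp_idl, comp_idr; reflexivity.
Qed.

Definition base_change_ob (P : Pt Y) : Pt X :=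
  {| pt_ob := pb_ob (pb P);
     pt_proj := pb_snd (pb P);
     pt_sect := pb_lift (pb P) (base_change_sect_square P);
     pt_split := pb_lift_snd (pb P) (base_change_sect_square P) |}.

Lemma base_change_map_square (P Q : Pt Y) (u : Hom P Q) :
  pt_proj Q ∘ (pt_map u ∘ pb_fst (pb P)) = f ∘ pb_snd (pb P).
Proof.
rewrite comp_assoc, pt_map_proj; apply pb_square.
Qed.

Definition base_change_map (P Q : Pt Y) (u : Hom P Q) :
  Hom (base_change_ob P) (base_change_ob Q).
Proof.
refine (@Build_PointHom C X (base_change_ob P) (base_change_ob Q)
          (pb_lift (pb Q) (base_change_map_square u)) _ _).
- apply pb_lift_snd.
- apply (pb_unique (p := pb Q)); cbn.
  + rewrite comp_assoc, !pb_lift_fst, <- comp_assoc, pb_lift_fst, comp_assoc.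
    rewrite pt_map_sect; reflexivity.
  + rewrite comp_assoc, !pb_lift_snd; reflexivity.
Defined.

Definition base_change : Functor (Pt Y) (Pt X).
Proof.
refine {| fob := base_change_ob; fmap := base_change_map |}.
- intros P; apply PointHom_eq, (pb_unique (p := pb P)); cbn.
  + rewrite pb_lift_fst, comp_idl, comp_idr; reflexivity.
  + rewrite pb_lift_snd, comp_idr; reflexivity.
- intros P Q S v u; apply PointHom_eq, (pb_unique (p := pb S)); cbn.
  + rewrite comp_assoc, !pb_lift_fst, <- !comp_assoc, pb_lift_fst; reflexivity.
  + rewrite comp_assoc, !pb_lift_snd; reflexivity.
Defined.

End ChangeOfBase.

Definition protomodular (C : Category) : Prop :=
  (forall (A X Y : C) (p : Hom A Y) (f : Hom X Y),
      split_epi p -> inhabited (Pullback p f)) /\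
  (forall (X Y : C) (f : Hom X Y) (pb : pullback_choice f),
      reflects_isos (base_change pb)).

(** * Algebraic coherence *)

Definition coherent (C D : Category) (F : Functor C D) : Prop :=
  preserves_finite_limits F /\
  forall (X Y Z : C) (f : Hom X Z) (g : Hom Y Z),
    jointly_strongly_epi f g -> jointly_strongly_epi (fmap F f) (fmap F g).

Definition algebraically_coherent (D : Category) : Prop :=
  finitely_complete D /\
  forall (X Y : D) (f : Hom X Y) (pb : pullback_choice f),
    coherent (base_change pb).

(* Main.v *)
Require Import Defs.
From Stdlib Require Import IndefiniteDescription.

(** Why the theorem holds.

    The functor [f^*] of a morphism [f : X -> Y] is conservative as soon as,
    for each point [(E, q, t)] over [Y], the projection [f^* E -> E] and the
    section [t] are jointly strongly epimorphic
    ([conservative_of_jointly_strongly_epi]): given [u] with [f^* u]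
    invertible, this applied to the kernel pair of [u] shows that [u] is monic,
    and applied to the codomain of [u] it shows that [u] is invertible.

    The heart of the proof is that this condition holds for a split
    monomorphism [s : B -> A], with retraction [p]
    ([section_jointly_strongly_epi]).  In the pointed category [Pt B] the map
    [s] is the initial map [0 -> A], so that [s^*] is a kernel functor, and
    being coherent it preserves jointly strongly epimorphic pairs.  So it is
    enough to exhibit the pair [(f^* E -> E, t)] as the kernel part of such a
    pair over [A].  Every [E] is the kernel of the projection
    [E * A -> A], the product being over [B]; with section [(t, 1)] this is a
    point over [A], and
      - [(1, q) : E -> E * A] has kernel part [s^* E -> E],
      - [t * 1 : A * A -> E * A] has kernel part [t : A -> E].
    Now [E * A] is also the pullback of [q] along the first projection
    [A * A -> A], a split epimorphism with the diagonal as section, and the two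
    maps above are the sections that this pullback inherits.  In a Mal'tsev
    category they are jointly strongly epimorphic ([maltsev_split_pullback]):
    a subobject of a pullback containing both is a relation, and relations are
    difunctional.

    A general [f : X -> Y] factors as the graph [(1, f) : X -> X * Y], which is
    a split monomorphism, followed by the projection to [Y].  If [X] has global
    support, multiplying by [X] is conservative, because the projections
    [X * Z -> Z] are strong epimorphisms
    ([pullback_stable_strong_epi_conservative]).  Hence [f^*] is conservative
    ([change_of_base_conservative]).  Finally an object that receives a map
    from one with global support has global support itself, so the pullbacks of
    split epimorphisms between objects with global support are the same in
    [GS C] and in [C]. *)

Set Implicit Arguments.
Unset Strict Implicit.
Unset Printing Implicit Defensive.

Local Open Scope cat_scope.

(** * Calculating with composites *)

(** Lets an equation between composites be used inside a right-nested one. *)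
Lemma precomp (C : Category) (X Y Z : C) (g : Hom Y Z) (f : Hom X Y)
    (h : Hom X Z) (e : g ∘ f = h) (W : C) (k : Hom W X) :
  g ∘ (f ∘ k) = h ∘ k.
Proof. now rewrite comp_assoc, e. Qed.

Lemma comp_assoc_r (C : Category) (X Y Z W : C) (h : Hom Z W) (g : Hom Y Z)
    (f : Hom X Y) :
  (h ∘ g) ∘ f = h ∘ (g ∘ f).
Proof. symmetry; apply comp_assoc. Qed.

Lemma pb_lift_fst_comp (C : Category) (X Y Z : C) (f : Hom X Z) (g : Hom Y Z)
    (pb : Pullback f g) (T : C) (a : Hom T X) (b : Hom T Y)
    (e : f ∘ a = g ∘ b) (W : C) (k : Hom W T) :
  pb_fst pb ∘ (pb_lift pb e ∘ k) = a ∘ k.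
Proof. apply precomp, pb_lift_fst. Qed.

Lemma pb_lift_snd_comp (C : Category) (X Y Z : C) (f : Hom X Z) (g : Hom Y Z)
    (pb : Pullback f g) (T : C) (a : Hom T X) (b : Hom T Y)
    (e : f ∘ a = g ∘ b) (W : C) (k : Hom W T) :
  pb_snd pb ∘ (pb_lift pb e ∘ k) = b ∘ k.
Proof. apply precomp, pb_lift_snd. Qed.

Lemma pt_split_comp (C : Category) (X : C) (P : Point X) (W : C)
    (k : Hom W X) :
  pt_proj P ∘ (pt_sect P ∘ k) = k.
Proof. now rewrite (precomp (pt_split P)), comp_idl. Qed.

Lemma pt_map_proj_comp (C : Category) (X : C) (P Q : Point X)
    (u : PointHom P Q) (W : C) (k : Hom W (pt_ob P)) :
  pt_proj Q ∘ (pt_map u ∘ k) = pt_proj P ∘ k.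
Proof. apply precomp, pt_map_proj. Qed.

Lemma pt_map_sect_comp (C : Category) (X : C) (P Q : Point X)
    (u : PointHom P Q) (W : C) (k : Hom W X) :
  pt_map u ∘ (pt_sect P ∘ k) = pt_sect Q ∘ k.
Proof. apply precomp, pt_map_sect. Qed.

Create HintDb cat discriminated.
Hint Rewrite comp_assoc_r comp_idl comp_idr pb_lift_fst pb_lift_snd
  pb_lift_fst_comp pb_lift_snd_comp pt_split pt_split_comp pt_map_proj
  pt_map_proj_comp pt_map_sect pt_map_sect_comp : cat.

Ltac cat := cbn; autorewrite with cat; try reflexivity.

Lemma iso_mono (C : Category) (X Y : C) (f : Hom X Y) : iso f -> mono f.
Proof.
intros [g [gf _]] T a b e.
rewrite <- (comp_idl a), <- (comp_idl b), <- gf, !comp_assoc_r, e.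
reflexivity.
Qed.

Lemma mono_split_iso (C : Category) (X Y : C) (m : Hom X Y) (r : Hom Y X) :
  mono m -> m ∘ r = idm Y -> iso m.
Proof.
intros hm e; exists r; split; [| exact e].
apply hm; rewrite (precomp e); cat.
Qed.

(** * Pullbacks from finite limits *)

Definition pullbacks (C : Category) : Type :=
  forall (X Y Z : C) (f : Hom X Z) (g : Hom Y Z), Pullback f g.

Inductive cospan_ob : Set := cleft | cright | cbase.

Definition cospan_hom (i j : cospan_ob) : Set :=
  match i, j with
  | cleft, cleft | cright, cright | cbase, cbase
  | cleft, cbase | cright, cbase => unit
  | _, _ => Empty_set
  end.

Definition cospan_id (i : cospan_ob) : cospan_hom i i :=
  match i with cleft => tt | cright => tt | cbase => tt end.

Definition cospan_comp (i j k : cospan_ob) :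
  cospan_hom j k -> cospan_hom i j -> cospan_hom i k.
Proof. destruct i, j, k; cbn; intros [] []; exact tt. Defined.

Definition cospan_shape : Category.
Proof.
refine {| Ob := cospan_ob; Hom := cospan_hom; idm := cospan_id;
          comp := cospan_comp |}.
- intros [] [] []; reflexivity.
- intros [] [] []; reflexivity.
- intros [] [] [] []; intros [] [] []; reflexivity.
Defined.

Lemma cospan_shape_finite : finite_category cospan_shape.
Proof.
split.
- exists (cleft :: cright :: cbase :: nil)%list; intros []; cbn; auto.
- intros [] [];
    first [ exists (tt :: nil)%list; intros []; now left
          | exists nil; intros [] ].
Qed.

Section CospanDiagram.
Variables (C : Category) (X Y Z : C) (f : Hom X Z) (g : Hom Y Z).

Definition cospan_fob (i : cospan_ob) : C :=
  match i with cleft => X | cright => Y | cbase => Z end.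

Definition cospan_fmap (i j : cospan_ob) :
  cospan_hom i j -> Hom (cospan_fob i) (cospan_fob j) :=
  match i, j return cospan_hom i j -> Hom (cospan_fob i) (cospan_fob j) with
  | cleft, cleft => fun _ => idm X
  | cright, cright => fun _ => idm Y
  | cbase, cbase => fun _ => idm Z
  | cleft, cbase => fun _ => f
  | cright, cbase => fun _ => g
  | _, _ => fun e => match e with end
  end.

Definition cospan_diagram : Functor cospan_shape C.
Proof.
refine (@Build_Functor cospan_shape C cospan_fob cospan_fmap _ _).
- intros []; reflexivity.
- intros [] [] [] [] []; cbn; now rewrite ?comp_idl, ?comp_idr.
Defined.

Definition cospan_cone (T : C) (a : Hom T X) (b : Hom T Y)
  (e : f ∘ a = g ∘ b) : Cone cospan_diagram.
Proof.
refine (@Build_Cone _ _ cospan_diagram T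
  (fun i => match i return Hom T (cospan_fob i) with
            | cleft => a | cright => b | cbase => f ∘ a end) _).
intros [] [] []; cbn; now rewrite ?comp_idl.
Defined.

Lemma finitely_complete_pullback :
  finitely_complete C -> inhabited (Pullback f g).
Proof.
intros HC; destruct (HC _ cospan_diagram cospan_shape_finite) as [L hL].
pose (l := leg L cleft : Hom (apex L) X).
pose (r := leg L cright : Hom (apex L) Y).
assert (lb : f ∘ l = leg L cbase)
  by exact (leg_natural L (tt : @Hom cospan_shape cleft cbase)).
assert (rb : g ∘ r = leg L cbase)
  by exact (leg_natural L (tt : @Hom cospan_shape cright cbase)).
assert (lift : forall (T : C) (a : Hom T X) (b : Hom T Y), f ∘ a = g ∘ b ->
                 {h : Hom T (apex L) | l ∘ h = a /\ r ∘ h = b}).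
{ intros T a b e; apply constructive_indefinite_description.
  destruct (hL (cospan_cone e)) as [h [hh _]]; exists h.
  split; [exact (hh cleft) | exact (hh cright)]. }
constructor.
refine {| pb_ob := apex L; pb_fst := l; pb_snd := r;
          pb_lift := fun T a b e => proj1_sig (lift T a b e) |}.
- now rewrite lb, rb.
- intros T a b e; exact (proj1 (proj2_sig (lift T a b e))).
- intros T a b e; exact (proj2 (proj2_sig (lift T a b e))).
- intros T u v eu ev.
  assert (e : f ∘ (l ∘ v) = g ∘ (r ∘ v))
    by now rewrite !comp_assoc, lb, rb.
  destruct (hL (cospan_cone e)) as [h [_ uniq]].
  transitivity h; [symmetry |]; apply uniq; intros []; cbn; trivial;
    rewrite <- lb, comp_assoc_r; now rewrite <- ?eu.
Qed.

End CospanDiagram.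

Definition finitely_complete_pullbacks (C : Category)
  (HC : finitely_complete C) : pullbacks C :=
  fun X Y Z f g =>
    proj1_sig (constructive_indefinite_description (fun _ => True)
      (let (pb) := finitely_complete_pullback f g HC in
       ex_intro _ pb I)).

(** * Points *)

Section PointPullback.
Variables (C : Category) (X : C) (P Q S : Pt X) (f : Hom P S) (g : Hom Q S).
Variable k : Pullback (pt_map f) (pt_map g).

Lemma pt_pullback_sect_square :
  pt_map f ∘ pt_sect P = pt_map g ∘ pt_sect Q.
Proof. now rewrite !pt_map_sect. Qed.

Definition pt_pullback_ob : Pt X.
Proof.
refine (@Build_Point C X (pb_ob k) (pt_proj P ∘ pb_fst k)
          (pb_lift k pt_pullback_sect_square) _).
abstract cat.
Defined.

Definition pt_pullback_fst : Hom pt_pullback_ob P.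
Proof.
refine (@Build_PointHom C X pt_pullback_ob P (pb_fst k) _ _); abstract cat.
Defined.

Definition pt_pullback_snd : Hom pt_pullback_ob Q.
Proof.
refine (@Build_PointHom C X pt_pullback_ob Q (pb_snd k) _ _).
- abstract (cbn; rewrite <- (pt_map_proj g), <- (pt_map_proj f), !comp_assoc_r;
            now rewrite (pb_square k)).
- abstract cat.
Defined.

Definition pt_pullback_lift (T : Pt X) (a : Hom T P) (b : Hom T Q)
  (e : f ∘ a = g ∘ b) : Hom T pt_pullback_ob.
Proof.
refine (@Build_PointHom C X T pt_pullback_ob
          (pb_lift k (f_equal (@pt_map _ _ _ _) e)) _ _).
- abstract cat.
- abstract (apply (pb_unique (p := k)); cat).
Defined.

(** The forgetful functor from points creates pullbacks. *)
Definition pt_pullback : Pullback f g.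
Proof.
refine {| pb_ob := pt_pullback_ob; pb_fst := pt_pullback_fst;
          pb_snd := pt_pullback_snd; pb_lift := pt_pullback_lift |}.
- apply PointHom_eq; exact (pb_square k).
- intros; apply PointHom_eq; cat.
- intros; apply PointHom_eq; cat.
- intros T u v eu ev; apply PointHom_eq, (pb_unique (p := k));
    [exact (f_equal (@pt_map _ _ _ _) eu) | exact (f_equal (@pt_map _ _ _ _) ev)].
Defined.

End PointPullback.

Definition pt_pullbacks (C : Category) (PB : pullbacks C) (X : C) :
  pullbacks (Pt X) :=
  fun P Q S f g => pt_pullback (PB _ _ _ (pt_map f) (pt_map g)).

(** A monomorphism of points has a trivial kernel pair, and kernel pairs of
    points are computed in the ambient category. *)
Lemma pt_mono (C : Category) (PB : pullbacks C) (X : C) (P Q : Pt X)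
    (m : Hom P Q) :
  mono m -> mono (pt_map m).
Proof.
intros hm T a b e.
pose (k := PB _ _ _ (pt_map m) (pt_map m)).
assert (h : pb_fst k = pb_snd k)
  by exact (f_equal (@pt_map _ _ _ _) (hm _ _ _ (pb_square (pt_pullback k)))).
rewrite <- (pb_lift_fst k e), h; apply pb_lift_snd.
Qed.

Lemma mono_pt (C : Category) (X : C) (P Q : Pt X) (m : Hom P Q) :
  mono (pt_map m) -> mono m.
Proof.
intros hm T a b e; apply PointHom_eq, hm, (f_equal (@pt_map _ _ _ _) e).
Qed.

Lemma pt_iso (C : Category) (X : C) (P Q : Pt X) (m : Hom P Q) :
  iso m -> iso (pt_map m).
Proof.
intros [n [nm mn]]; exists (pt_map n); split;
  [exact (f_equal (@pt_map _ _ _ _) nm) | exact (f_equal (@pt_map _ _ _ _) mn)].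
Qed.

Lemma iso_pt (C : Category) (X : C) (P Q : Pt X) (m : Hom P Q) :
  iso (pt_map m) -> iso m.
Proof.
intros [n [nm mn]].
assert (np : pt_proj P ∘ n = pt_proj Q)
  by (rewrite <- (pt_map_proj m), comp_assoc_r, mn; cat).
assert (ns : n ∘ pt_sect Q = pt_sect P)
  by (rewrite <- (pt_map_sect m), comp_assoc, nm; cat).
exists (@Build_PointHom _ _ Q P n np ns); split; apply PointHom_eq; assumption.
Qed.

(** A subobject of the middle point containing both legs inherits the structure
    of a point: its section comes from that of the first leg. *)
Lemma pt_jointly_strongly_epi (C : Category) (PB : pullbacks C) (X : C)
    (P Q S : Pt X) (f : Hom P S) (g : Hom Q S) :
  jointly_strongly_epi f g <-> jointly_strongly_epi (pt_map f) (pt_map g).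
Proof.
split.
- intros h M m hm [f' ef] [g' eg].
  assert (ms : m ∘ (f' ∘ pt_sect P) = pt_sect S)
    by now rewrite (precomp ef), pt_map_sect.
  assert (split : (pt_proj S ∘ m) ∘ (f' ∘ pt_sect P) = idm X)
    by (rewrite comp_assoc_r, ms; apply pt_split).
  pose (N := @Build_Point C X M _ _ split : Pt X).
  pose (n := @Build_PointHom C X N S m eq_refl ms : Hom N S).
  assert (fp : pt_proj N ∘ f' = pt_proj P) by (cbn; rewrite comp_assoc_r, ef; cat).
  assert (gp : pt_proj N ∘ g' = pt_proj Q) by (cbn; rewrite comp_assoc_r, eg; cat).
  assert (gs : g' ∘ pt_sect Q = pt_sect N)
    by (apply hm; cbn; rewrite ms, (precomp eg); cat).
  apply (pt_iso (m := n)), h.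
  + exact (mono_pt (m := n) hm).
  + exists (@Build_PointHom C X P N f' fp eq_refl); apply PointHom_eq, ef.
  + exists (@Build_PointHom C X Q N g' gp gs); apply PointHom_eq, eg.
- intros h M m hm [f' ef] [g' eg]; apply iso_pt, h.
  + exact (pt_mono PB hm).
  + exists (pt_map f'); exact (f_equal (@pt_map _ _ _ _) ef).
  + exists (pt_map g'); exact (f_equal (@pt_map _ _ _ _) eg).
Qed.

(** Points in a category of points are nothing new: this is one half of the
    isomorphism between the points over [A] in [Pt X] and the
    points over the object [pt_ob A] of the ambient category. *)
Section NestedPoints.
Variables (C : Category) (X : C) (A : Pt X).

Definition nested_total (P : Point (pt_ob A)) : Pt X.
Proof.
refine (@Build_Point C X (pt_ob P) (pt_proj A ∘ pt_proj P)
          (pt_sect P ∘ pt_sect A) _).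
abstract cat.
Defined.

Definition nested_proj (P : Point (pt_ob A)) : Hom (nested_total P) A.
Proof.
refine (@Build_PointHom C X (nested_total P) A (pt_proj P) _ _); abstract cat.
Defined.

Definition nested_sect (P : Point (pt_ob A)) : Hom A (nested_total P).
Proof.
refine (@Build_PointHom C X A (nested_total P) (pt_sect P) _ _); abstract cat.
Defined.

Definition nested_point (P : Point (pt_ob A)) : Pt A.
Proof.
refine (@Build_Point (Pt X) A _ (nested_proj P) (nested_sect P) _).
abstract (apply PointHom_eq; cat).
Defined.

Variables (P Q : Point (pt_ob A)) (u : PointHom P Q).

Definition nested_total_hom : Hom (nested_total P) (nested_total Q).
Proof.
refine (@Build_PointHom C X (nested_total P) (nested_total Q) (pt_map u) _ _);
  abstract cat.
Defined.

Definition nested_hom : Hom (nested_point P) (nested_point Q).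
Proof.
refine (@Build_PointHom (Pt X) A (nested_point P) (nested_point Q)
          nested_total_hom _ _); abstract (apply PointHom_eq; cat).
Defined.

End NestedPoints.

(** * Split pullbacks in Mal'tsev categories *)

Section Maltsev.
Variables (C : Category) (PB : pullbacks C).
Hypothesis HC : maltsev C.

(** Write [x R v] for the relation [(m1, m2)] of [E] and [V].  On the object
    [M] of related pairs, put [(x, v) S (x', v')] when [x R v'].  This is
    reflexive, hence symmetric.  If [x R v'], [x' R v'] and [x' R v], then
    [(x', v) S (x, v')] because [x' R v'], so [(x, v') S (x', v)], which says
    that [x R v]. *)
Lemma maltsev_difunctional (M E V : C) (m1 : Hom M E) (m2 : Hom M V)
    (jm : forall (T : C) (a b : Hom T M),
        m1 ∘ a = m1 ∘ b -> m2 ∘ a = m2 ∘ b -> a = b)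
    (T : C) (a b c : Hom T M) :
  m2 ∘ a = m2 ∘ b -> m1 ∘ b = m1 ∘ c ->
  exists d : Hom T M, m1 ∘ d = m1 ∘ a /\ m2 ∘ d = m2 ∘ c.
Proof.
intros ab bc.
pose (k := PB m1 m1).
pose (S := PB (m2 ∘ pb_snd k) m2).
pose (d0 := pb_fst k ∘ pb_fst S).
pose (d1 := pb_snd S).
pose (w := pb_snd k ∘ pb_fst S).
assert (w1 : m1 ∘ w = m1 ∘ d0)
  by (unfold w, d0; rewrite !comp_assoc; now rewrite (pb_square k)).
assert (w2 : m2 ∘ w = m2 ∘ d1)
  by (unfold w, d1; rewrite comp_assoc; apply (pb_square S)).
assert (rel : internal_relation d0 d1).
{ intros U x y e0 e1; unfold d0, d1 in e0, e1.
  rewrite !comp_assoc_r in e0.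
  apply (pb_unique (p := S)); [| exact e1].
  apply (pb_unique (p := k)); [exact e0 |].
  assert (ew : w ∘ x = w ∘ y).
  { apply jm.
    - rewrite !comp_assoc, w1; unfold d0; rewrite !comp_assoc_r; now rewrite e0.
    - rewrite !comp_assoc, w2; unfold d1; rewrite !comp_assoc_r; now rewrite e1. }
  unfold w in ew; now rewrite !comp_assoc_r in ew. }
(* How to produce generalized elements of [S]. *)
assert (pair : forall (U : C) (x y z : Hom U M),
           m1 ∘ z = m1 ∘ x -> m2 ∘ z = m2 ∘ y ->
           exists h : Hom U (pb_ob S), d0 ∘ h = x /\ d1 ∘ h = y).
{ intros U x y z ex ey.
  pose (xz := pb_lift k (eq_sym ex)).
  assert (e : m2 ∘ pb_snd k ∘ xz = m2 ∘ y) by (unfold xz; cat; exact ey).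
  exists (pb_lift S e); unfold d0, d1, xz; split; cat. }
assert (refl : rel_reflexive d0 d1) by (apply (pair _ _ _ (idm M)); cat).
destruct (proj2 HC _ _ _ _ rel refl) as [_ [[s [s0 s1]] _]].
destruct (pair _ c a b bc (eq_sym ab)) as [h [h0 h1]].
(* [h] is the generalized element [(x', v) S (x, v')]; [s] swaps it. *)
exists (w ∘ (s ∘ h)); split.
- now rewrite (precomp w1), comp_assoc_r, (precomp s0), h1.
- now rewrite (precomp w2), comp_assoc_r, (precomp s1), h0.
Qed.

(** Let [M] be a subobject of the pullback containing [i] and [j], seen as a
    relation.  For [(e, v)] in the pullback and [a] the common image in [A], [i]
    gives [e M (sect V a)], [j] gives [(sect U a) M (sect V a)] and
    [(sect U a) M v]; difunctionality gives [e M v]. *)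
Lemma maltsev_split_pullback (A : C) (U V : Point A)
    (k : Pullback (pt_proj U) (pt_proj V))
    (i : Hom (pt_ob U) (pb_ob k)) (j : Hom (pt_ob V) (pb_ob k)) :
  pb_fst k ∘ i = idm _ -> pb_snd k ∘ i = pt_sect V ∘ pt_proj U ->
  pb_fst k ∘ j = pt_sect U ∘ pt_proj V -> pb_snd k ∘ j = idm _ ->
  jointly_strongly_epi i j.
Proof.
intros i1 i2 j1 j2 M m hm [i' ei] [j' ej].
pose (m1 := pb_fst k ∘ m).
pose (m2 := pb_snd k ∘ m).
assert (jm : forall (T : C) (a b : Hom T M),
           m1 ∘ a = m1 ∘ b -> m2 ∘ a = m2 ∘ b -> a = b).
{ intros T a b ea eb; apply hm, (pb_unique (p := k));
    rewrite !comp_assoc; assumption. }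
assert (i1' : m1 ∘ i' = idm _) by (unfold m1; now rewrite comp_assoc_r, ei).
assert (i2' : m2 ∘ i' = pt_sect V ∘ pt_proj U)
  by (unfold m2; now rewrite comp_assoc_r, ei).
assert (j1' : m1 ∘ j' = pt_sect U ∘ pt_proj V)
  by (unfold m1; now rewrite comp_assoc_r, ej).
assert (j2' : m2 ∘ j' = idm _) by (unfold m2; now rewrite comp_assoc_r, ej).
destruct (@maltsev_difunctional M _ _ m1 m2 jm _ (i' ∘ pb_fst k)
            (j' ∘ (pt_sect V ∘ (pt_proj U ∘ pb_fst k))) (j' ∘ pb_snd k))
  as [d [d1 d2]].
- rewrite (precomp i2'), (precomp j2'); cat.
- rewrite (precomp j1'), (precomp j1'), (pb_square k); cat.
- apply (mono_split_iso (r := d) hm), (pb_unique (p := k)); rewrite comp_idr.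
  + change (pb_fst k ∘ (m ∘ d) = pb_fst k); rewrite comp_assoc.
    change (m1 ∘ d = pb_fst k).
    now rewrite d1, (precomp i1'), comp_idl.
  + rewrite comp_assoc; change (m2 ∘ d = pb_snd k).
    now rewrite d2, (precomp j2'), comp_idl.
Qed.

End Maltsev.

(** * Change of base along split monomorphisms *)

Section SplitMono.
Variables (C : Category) (PB : pullbacks C).
Hypothesis HC : maltsev C.
Hypothesis Hcoh : forall X : C, algebraically_coherent (Pt X).
Variables (B A : C) (p : Hom A B) (s : Hom B A) (ps : p ∘ s = idm B).
Variable Q : Point A.

Local Notation q := (pt_proj Q).
Local Notation t := (pt_sect Q).

Definition base_point : Pt B := @Build_Point C B A p s ps.

Definition terminal_point : Pt B :=
  @Build_Point C B B (idm B) (idm B) (comp_idl (idm B)).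

(** The retraction turns [s] into the initial map of the pointed category
    [Pt B], so that coherence of the fibres applies to [s^*]. *)
Definition section_hom : Hom terminal_point base_point.
Proof.
refine (@Build_PointHom C B terminal_point base_point s _ _);
  [exact ps | exact (comp_idr s)].
Defined.

Let R := PB p p.

Definition kernel_pair_diag : Hom A (pb_ob R) :=
  pb_lift R (eq_refl (p ∘ idm A)).

Definition kernel_pair_fst : Point A.
Proof.
refine (@Build_Point C A (pb_ob R) (pb_fst R) kernel_pair_diag _).
apply pb_lift_fst.
Defined.

Definition kernel_pair_snd : Point A.
Proof.
refine (@Build_Point C A (pb_ob R) (pb_snd R) kernel_pair_diag _).
apply pb_lift_snd.
Defined.

(** The product of [Q] with [A] over [B], presented as a pullback along
    [pb_fst R] in order to have the form of [maltsev_split_pullback]. *)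
Let W := PB q (pb_fst R).

Lemma total_sect_square : q ∘ t = pb_fst R ∘ kernel_pair_diag.
Proof. unfold kernel_pair_diag; cat. Qed.

Definition total_point : Point A.
Proof.
refine (@Build_Point C A (pb_ob W) (pb_snd R ∘ pb_snd W)
          (pb_lift W total_sect_square) _).
unfold kernel_pair_diag; cat.
Defined.

Lemma graph_square : q ∘ idm _ = pb_fst R ∘ (kernel_pair_diag ∘ q).
Proof. unfold kernel_pair_diag; cat. Qed.

(** The map [(1, q)]. *)
Definition graph_hom : PointHom Q total_point.
Proof.
refine (@Build_PointHom C A Q total_point (pb_lift W graph_square) _ _).
- unfold kernel_pair_diag; cat.
- apply (pb_unique (p := W)); unfold kernel_pair_diag; cat.
Defined.

Lemma zero_square : q ∘ (t ∘ pb_fst R) = pb_fst R ∘ idm _.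
Proof. cat. Qed.

(** The map [t * 1]. *)
Definition zero_hom : PointHom kernel_pair_snd total_point.
Proof.
refine (@Build_PointHom C A kernel_pair_snd total_point
          (pb_lift W zero_square) _ _).
- cat.
- apply (pb_unique (p := W)); cbn; unfold kernel_pair_diag; cat.
Defined.

Lemma graph_zero_jointly_strongly_epi :
  jointly_strongly_epi (pt_map graph_hom) (pt_map zero_hom).
Proof.
apply (maltsev_split_pullback PB HC (U := Q) (V := kernel_pair_fst) (k := W)
         (i := pb_lift W graph_square) (j := pb_lift W zero_square));
  cat.
Qed.

(** Applying [s^*] to the preceding pair gives, up to the isomorphism between
    [pt_ob Q] and the kernel [F] of [total_point], the pair of this lemma.  A
    subobject [u] of [pt_ob Q] is carried into [F] by the monomorphism
    [e |-> (e, (q e, s p q e), p q e)], and the inverse obtained there is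
    carried back. *)
Lemma section_jointly_strongly_epi (k : Pullback q s) :
  jointly_strongly_epi (pb_fst k) t.
Proof.
intros M u hu [k' ek] [t' et].
pose (ch := (fun P => pt_pullbacks PB (pt_proj P) section_hom)
            : pullback_choice section_hom).
pose (F := PB (pb_snd R ∘ pb_snd W) s).
pose (gF := fmap (base_change ch) (nested_hom (A := base_point) graph_hom)).
pose (zF := fmap (base_change ch) (nested_hom (A := base_point) zero_hom)).
assert (H : jointly_strongly_epi (Z := pb_ob F)
              (pt_map (pt_map gF)) (pt_map (pt_map zF))).
{ apply (pt_jointly_strongly_epi PB (pt_map gF) (pt_map zF)).
  apply (pt_jointly_strongly_epi (pt_pullbacks PB (X := B)) gF zF).
  apply (proj2 (proj2 (Hcoh B) _ _ section_hom ch)).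
  apply (pt_jointly_strongly_epi (pt_pullbacks PB (X := B))).
  apply (pt_jointly_strongly_epi PB).
  exact graph_zero_jointly_strongly_epi. }
(* [m] sends [x] to [((u x, (q u x, s p q u x)), p q u x)] in [F]. *)
assert (e0 : p ∘ (s ∘ (p ∘ (q ∘ u))) = p ∘ (q ∘ u))
  by now rewrite (precomp ps), comp_idl.
assert (e1 : q ∘ u = pb_fst R ∘ pb_lift R (eq_sym e0)) by cat.
assert (e2 : pb_snd R ∘ pb_snd W ∘ pb_lift W e1 = s ∘ (p ∘ (q ∘ u))) by cat.
pose (m := pb_lift F e2).
assert (hm : mono m).
{ intros T a b e; apply hu.
  apply (f_equal (fun x => pb_fst W ∘ (pb_fst F ∘ x))) in e.
  unfold m in e; autorewrite with cat in e; exact e. }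
destruct (H _ m hm) as [n [nm mn]].
(* The leg [gF] comes from [s^*] of [Q], on which [q] lands in the image of
   [s]. *)
- pose (K := PB q s).
  pose (h := pb_lift k (pb_square K)).
  exists (k' ∘ h).
  assert (euk : u ∘ (k' ∘ h) = pb_fst K) by (rewrite (precomp ek); apply pb_lift_fst).
  unfold m.
  apply (pb_unique (p := F)); cat.
  + change (PB (pt_proj Q) s) with K.
    apply (pb_unique (p := W)); cat; rewrite ?euk; cat.
    unfold kernel_pair_diag; apply (pb_unique (p := R)); cat; rewrite ?euk; cat.
    rewrite (pb_square K), (precomp ps); cat.
  + change (PB (pt_proj Q) s) with K.
    rewrite euk, (pb_square K), (precomp ps); cat.
(* The leg [zF] comes from pairs [(a, a')] with [p a = p a'] and [a' = s b],
   so that [b = p a] and the pair is determined by [a]. *)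
- pose (K := PB (pb_snd R) s).
  exists (t' ∘ (pb_fst R ∘ pb_fst K)).
  assert (eut : u ∘ (t' ∘ (pb_fst R ∘ pb_fst K)) = t ∘ (pb_fst R ∘ pb_fst K))
    by apply (precomp et).
  assert (qt : q ∘ (t ∘ (pb_fst R ∘ pb_fst K)) = pb_fst R ∘ pb_fst K)
    by (cat).
  assert (eb : p ∘ (pb_fst R ∘ pb_fst K) = pb_snd K).
  { rewrite comp_assoc, (pb_square R), comp_assoc_r, (pb_square K), (precomp ps).
    cat. }
  unfold m; apply (pb_unique (p := F)); cat;
    change (PB (pb_snd R) s) with K.
  + apply (pb_unique (p := W)); cat; rewrite ?eut; cat.
    apply (pb_unique (p := R)); cat; rewrite eut, qt; cat.
    rewrite eb; symmetry; apply pb_square.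
  + now rewrite eut, qt, eb.
(* [F] receives [pt_ob Q] by the formula defining [m], without [u]. *)
- assert (d0 : p ∘ (s ∘ (p ∘ q)) = p ∘ q) by now rewrite (precomp ps), comp_idl.
  assert (d1 : q ∘ idm _ = pb_fst R ∘ pb_lift R (eq_sym d0)) by cat.
  assert (d2 : pb_snd R ∘ pb_snd W ∘ pb_lift W d1 = s ∘ (p ∘ q)) by cat.
  apply (mono_split_iso (r := n ∘ pb_lift F d2) hu).
  assert (um : u = pb_fst W ∘ (pb_fst F ∘ m)) by (unfold m; cat).
  rewrite um, !comp_assoc_r, (precomp mn); cat.
Qed.

End SplitMono.

(** * Conservativity *)

(** The kernel pair [N] of [u], with its diagonal [d], becomes trivial over [X]
    since [v] is monic; so both the section of [N] and the projection from its
    pullback factor through [d], and [d] is invertible.  Thus [u] is monic, and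
    the same two factorizations, now through [u] itself, make it invertible. *)
Lemma conservative_of_jointly_strongly_epi (C : Category) (PB : pullbacks C) (X Y : C)
    (f : Hom X Y)
    (Hf : forall (Q : Point Y) (k : Pullback (pt_proj Q) f),
        jointly_strongly_epi (pb_fst k) (pt_sect Q))
    (P Q : Point Y) (u : PointHom P Q)
    (kP : Pullback (pt_proj P) f) (kQ : Pullback (pt_proj Q) f)
    (v : Hom (pb_ob kP) (pb_ob kQ)) :
  pb_fst kQ ∘ v = pt_map u ∘ pb_fst kP -> pb_snd kQ ∘ v = pb_snd kP ->
  iso v -> iso (pt_map u).
Proof.
intros v1 v2 hv.
assert (vm := iso_mono hv).
destruct hv as [w [wv vw]].
assert (hu : mono (pt_map u)).
{ pose (N := PB _ _ _ (pt_map u) (pt_map u)).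
  assert (e0 : pt_map u ∘ idm _ = pt_map u ∘ idm _) by reflexivity.
  pose (d := pb_lift N e0).
  assert (et : pt_proj P ∘ pb_fst N ∘ (d ∘ pt_sect P) = idm Y)
    by (unfold d; cat).
  pose (NP := @Build_Point C Y (pb_ob N) _ _ et).
  pose (k := PB _ _ _ (pt_proj NP) f).
  assert (sq1 : pt_proj P ∘ (pb_fst N ∘ pb_fst k) = f ∘ pb_snd k)
    by (rewrite comp_assoc; apply (pb_square k)).
  assert (sq2 : pt_proj P ∘ (pb_snd N ∘ pb_fst k) = f ∘ pb_snd k).
  { rewrite <- sq1, <- (pt_map_proj u), !comp_assoc_r.
    now rewrite (comp_assoc (pt_map u) (pb_fst N)), (pb_square N), comp_assoc_r. }
  assert (same : pb_lift kP sq1 = pb_lift kP sq2).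
  { apply vm, (pb_unique (p := kQ)).
    - rewrite !(precomp v1), !comp_assoc_r, !pb_lift_fst, !comp_assoc.
      now rewrite (pb_square N).
    - rewrite !(precomp v2); cat. }
  assert (n12 : pb_fst N ∘ pb_fst k = pb_snd N ∘ pb_fst k).
  { rewrite <- (pb_lift_fst kP sq1), same; apply pb_lift_fst. }
  assert (dm : mono d).
  { intros T a b e; apply (f_equal (fun x => pb_fst N ∘ x)) in e.
    unfold d in e; autorewrite with cat in e; exact e. }
  destruct (Hf NP k _ d dm) as [r [rd dr]].
  - exists (pb_fst N ∘ pb_fst k); unfold d.
    apply (pb_unique (p := N)); cat; exact n12.
  - exists (pt_sect P); reflexivity.
  - assert (n : pb_fst N = pb_snd N).
    { change (d ∘ r = idm (pb_ob N)) in dr.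
      rewrite <- (comp_idr (pb_fst N)), <- (comp_idr (pb_snd N)), <- dr.
      unfold d; cat. }
    intros T a b e.
    rewrite <- (pb_lift_fst N e), n; apply pb_lift_snd. }
apply (Hf Q kQ _ _ hu).
- exists (pb_fst kP ∘ w); rewrite comp_assoc, <- v1, comp_assoc_r, vw; cat.
- exists (pt_sect P); apply pt_map_sect.
Qed.

(** Two maps equalized by [u] agree after composition with the pullback of [x],
    which is epic, so [u] is monic.  The pullback [pb_snd k'] of [x] factors
    through [u] because [v] is invertible, and it is a strong epimorphism, so [u]
    is invertible. *)
Lemma pullback_stable_strong_epi_conservative (C : Category) (PB : pullbacks C)
    (X T : C) (x : Hom X T) (hx : pullback_stable_strong_epi x)
    (A A' : C) (a : Hom A T) (a' : Hom A' T) (u : Hom A A')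
    (k : Pullback x a) (k' : Pullback x a') (v : Hom (pb_ob k) (pb_ob k')) :
  a' ∘ u = a -> pb_fst k' ∘ v = pb_fst k -> pb_snd k' ∘ v = u ∘ pb_snd k ->
  iso v -> iso u.
Proof.
intros au v1 v2 hv.
assert (vm := iso_mono hv).
destruct hv as [w [wv vw]].
assert (hu : mono u).
{ intros Z b c e.
  assert (abc : a ∘ b = a ∘ c) by now rewrite <- au, !comp_assoc_r, e.
  pose (z := PB _ _ _ x (a ∘ b)).
  assert (eb : x ∘ pb_fst z = a ∘ (b ∘ pb_snd z))
    by (rewrite comp_assoc; apply (pb_square z)).
  assert (ec : x ∘ pb_fst z = a ∘ (c ∘ pb_snd z)).
  { rewrite eb, !(comp_assoc a); exact (f_equal (fun c => c ∘ pb_snd z) abc). }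
  apply (proj1 (proj2 hx _ _ z)).
  rewrite <- (pb_lift_snd k eb), <- (pb_lift_snd k ec); f_equal.
  apply vm, (pb_unique (p := k')).
  - rewrite !(precomp v1); cat.
  - rewrite !(precomp v2); cat.
    rewrite !(comp_assoc u); now rewrite e. }
destruct (proj2 (proj2 hx _ _ k') _ _ u (pb_snd k ∘ w) (idm A') hu)
  as [d [_ ud]].
- rewrite comp_assoc, <- v2, comp_assoc_r, vw; cat.
- exact (mono_split_iso hu ud).
Qed.

(** For [T] terminal, [XY] is the product of [X] and [Y], and the point
    [product_point P] is the product of [P] with [X]; its pullback along the
    graph of [f] is the pullback of [P] along [f]. *)
Section Graph.
Variables (C : Category) (PB : pullbacks C).
Variables (X Y T : C) (f : Hom X Y) (x : Hom X T) (y : Hom Y T).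
Hypothesis yf : y ∘ f = x.

Let XY := PB x y.

Lemma graph_map_square : x ∘ idm X = y ∘ f.
Proof. rewrite yf; apply comp_idr. Qed.

Definition graph_map : Hom X (pb_ob XY) := pb_lift XY graph_map_square.

Section ProductPoint.
Variable P : Point Y.

Let XP := PB x (y ∘ pt_proj P).

Lemma product_proj_square : x ∘ pb_fst XP = y ∘ (pt_proj P ∘ pb_snd XP).
Proof. rewrite comp_assoc; apply pb_square. Qed.

Lemma product_sect_square :
  x ∘ pb_fst XY = y ∘ pt_proj P ∘ (pt_sect P ∘ pb_snd XY).
Proof. cat; apply pb_square. Qed.

Definition product_point : Point (pb_ob XY).
Proof.
refine (@Build_Point C (pb_ob XY) (pb_ob XP) (pb_lift XY product_proj_square)
          (pb_lift XP product_sect_square) _).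
apply (pb_unique (p := XY)); cat.
Defined.

Variable k : Pullback (pt_proj P) f.

Lemma product_fst_square :
  x ∘ pb_snd k = y ∘ pt_proj P ∘ pb_fst k.
Proof. now rewrite comp_assoc_r, (pb_square k), (precomp yf). Qed.

Lemma product_lift_square (S : C) (a : Hom S (pb_ob XP)) (b : Hom S X) :
  pt_proj product_point ∘ a = graph_map ∘ b ->
  pb_fst XP ∘ a = b /\ pt_proj P ∘ (pb_snd XP ∘ a) = f ∘ b.
Proof.
intros e; split.
- apply (f_equal (fun c => pb_fst XY ∘ c)) in e; unfold graph_map in e; cbn in e.
  autorewrite with cat in e; exact e.
- apply (f_equal (fun c => pb_snd XY ∘ c)) in e; unfold graph_map in e; cbn in e.
  autorewrite with cat in e; exact e.
Qed.

Definition product_pullback : Pullback (pt_proj product_point) graph_map.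
Proof.
refine (@Build_Pullback C _ _ _ (pt_proj product_point) graph_map
          (pb_ob k) (pb_lift XP product_fst_square) (pb_snd k) _
          (fun S a b e => pb_lift k (proj2 (product_lift_square e))) _ _ _).
- unfold graph_map; apply (pb_unique (p := XY)); cat; apply pb_square.
- intros S a b e; destruct (product_lift_square e) as [e1 e2].
  apply (pb_unique (p := XP)); cat; now symmetry.
- intros; apply pb_lift_snd.
- intros S a b ea eb; apply (pb_unique (p := k)); [| exact eb].
  apply (f_equal (fun c => pb_snd XP ∘ c)) in ea; autorewrite with cat in ea.
  exact ea.
Defined.

End ProductPoint.

Section ProductHom.
Variables (P Q : Point Y) (u : PointHom P Q).

Let XP := PB x (y ∘ pt_proj P).

Lemma product_hom_square :
  x ∘ pb_fst XP = y ∘ pt_proj Q ∘ (pt_map u ∘ pb_snd XP).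
Proof. cat; rewrite comp_assoc; apply pb_square. Qed.

Definition product_hom : PointHom (product_point P) (product_point Q).
Proof.
refine (@Build_PointHom C _ (product_point P) (product_point Q)
          (pb_lift (PB x (y ∘ pt_proj Q)) product_hom_square) _ _).
- apply (pb_unique (p := XY)); cat.
- apply (pb_unique (p := PB x (y ∘ pt_proj Q))); cat.
Defined.

End ProductHom.

Hypothesis HC : maltsev C.
Hypothesis Hcoh : forall X : C, algebraically_coherent (Pt X).
Hypothesis hx : pullback_stable_strong_epi x.

Lemma change_of_base_conservative (P Q : Point Y) (u : PointHom P Q)
    (kP : Pullback (pt_proj P) f) (kQ : Pullback (pt_proj Q) f)
    (v : Hom (pb_ob kP) (pb_ob kQ)) :
  pb_fst kQ ∘ v = pt_map u ∘ pb_fst kP -> pb_snd kQ ∘ v = pb_snd kP ->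
  iso v -> iso (pt_map u).
Proof.
intros v1 v2 hv.
assert (hXu : iso (pt_map (product_hom u))).
{ assert (pg : pb_fst XY ∘ graph_map = idm X) by apply pb_lift_fst.
  apply (conservative_of_jointly_strongly_epi PB
           (section_jointly_strongly_epi PB HC Hcoh pg)
           (kP := product_pullback kP) (kQ := product_pullback kQ) (v := v)).
  - apply (pb_unique (p := PB x (y ∘ pt_proj Q))); cat; assumption.
  - exact v2.
  - exact hv. }
apply (pullback_stable_strong_epi_conservative PB hx (a' := y ∘ pt_proj Q)
         (v := pt_map (product_hom u)) (a := y ∘ pt_proj P)); cat.
exact hXu.
Qed.

End Graph.

(** * Objects with global support *)

Lemma terminal_unique (C : Category) (T X : C) (a b : Hom X T) :
  is_terminal T -> a = b.
Proof.
intros hT; destruct (hT X) as [c [_ uniq]].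
now rewrite <- (uniq a I), <- (uniq b I).
Qed.

Lemma strong_epi_cancel (C : Category) (U V W : C) (i : Hom U V) (g : Hom V W) :
  strong_epi (g ∘ i) -> strong_epi g.
Proof.
intros [he hs]; split.
- intros Z a b eq; apply he; rewrite !comp_assoc; now rewrite eq.
- intros M Z m a b hm eq.
  destruct (hs M Z m (a ∘ i) b hm) as [d [_ md]].
  + rewrite !comp_assoc; now rewrite eq.
  + exists d; split; [| exact md].
    apply hm; rewrite comp_assoc, md; now symmetry.
Qed.

(** The pullbacks of [X -> 1] factor through those of [P -> 1]. *)
Lemma global_support_of_hom (C : Category) (PB : pullbacks C) (X P : C)
    (h : Hom X P) :
  global_support X -> global_support P.
Proof.
intros [T [x [hT [hx hxs]]]].
destruct (hT P) as [t _].
assert (th : t ∘ h = x) by exact (terminal_unique _ _ hT).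
exists T, t; split; [exact hT | split].
- apply (strong_epi_cancel (i := h)); now rewrite th.
- intros Z g k; pose (kx := PB _ _ _ x g).
  assert (e : t ∘ (h ∘ pb_fst kx) = g ∘ pb_snd kx)
    by (rewrite (precomp th); apply pb_square).
  apply (strong_epi_cancel (i := pb_lift k e)); rewrite pb_lift_snd.
  apply hxs.
Qed.

Section GSPullback.
Variables (C : Category) (X Y Z : GS C) (f : Hom X Z) (g : Hom Y Z).

Definition GS_pullback (k : @Pullback C _ _ _ f g)
  (hk : global_support (pb_ob k)) : Pullback f g :=
  @Build_Pullback (GS C) X Y Z f g (exist _ (pb_ob k) hk) (pb_fst k) (pb_snd k)
    (pb_square k) (fun T => @pb_lift _ _ _ _ _ _ k (proj1_sig T))
    (fun T => @pb_lift_fst _ _ _ _ _ _ k (proj1_sig T))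
    (fun T => @pb_lift_snd _ _ _ _ _ _ k (proj1_sig T))
    (fun T => @pb_unique _ _ _ _ _ _ k (proj1_sig T)).

(** A pullback in [GS C] is a priori universal only among objects with global
    support.  Once some pullback in [C] has global support the two are
    isomorphic, so the former is universal in [C] too. *)
Definition pullback_of_GS (k : @Pullback C _ _ _ f g)
  (hk : global_support (pb_ob k)) (l : Pullback f g) : @Pullback C _ _ _ f g.
Proof.
pose (K := exist _ (pb_ob k) hk : GS C).
pose (h := @pb_lift (GS C) _ _ _ _ _ l K _ _ (pb_square k)
           : @Hom C (pb_ob k) (proj1_sig (pb_ob l))).
assert (h1 : @comp C _ _ _ (pb_fst l) h = pb_fst k)
  by exact (@pb_lift_fst (GS C) _ _ _ _ _ l K _ _ (pb_square k)).
assert (h2 : @comp C _ _ _ (pb_snd l) h = pb_snd k)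
  by exact (@pb_lift_snd (GS C) _ _ _ _ _ l K _ _ (pb_square k)).
pose (h' := pb_lift k (pb_square l)).
assert (hh : @comp C _ _ _ h h' = idm _).
{ apply (@pb_unique (GS C) _ _ _ _ _ l (pb_ob l)); cbn.
  - rewrite (precomp h1); unfold h'; cat.
  - rewrite (precomp h2); unfold h'; cat. }
refine (@Build_Pullback C _ _ _ f g (proj1_sig (pb_ob l)) (pb_fst l) (pb_snd l)
          (pb_square l) (fun T a b e => @comp C _ _ _ h (pb_lift k e)) _ _ _).
- intros T a b e; rewrite (precomp h1); apply pb_lift_fst.
- intros T a b e; rewrite (precomp h2); apply pb_lift_snd.
- intros T a b ea eb.
  assert (e : @comp C _ _ _ h' a = @comp C _ _ _ h' b).
  { unfold h'; apply (pb_unique (p := k)); cat; assumption. }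
  rewrite <- (comp_idl a), <- (comp_idl b), <- hh, !comp_assoc_r.
  now rewrite e.
Defined.

End GSPullback.

Theorem theorem6p6 (C : Category) (HC : maltsev C)
  (Hcoh : forall X : C, algebraically_coherent (Pt X)) :
  protomodular (GS C) /\
  ((forall X : C, global_support X) -> protomodular C).
Proof.
pose (PB := finitely_complete_pullbacks (proj1 HC)).
assert (cons : forall (X Y : C) (f : Hom X Y) (P Q : Point Y)
    (u : PointHom P Q) (kP : Pullback (pt_proj P) f)
    (kQ : Pullback (pt_proj Q) f) (v : Hom (pb_ob kP) (pb_ob kQ)),
    global_support X ->
    pb_fst kQ ∘ v = pt_map u ∘ pb_fst kP -> pb_snd kQ ∘ v = pb_snd kP ->
    iso v -> iso (pt_map u)).
{ intros X Y f P Q u kP kQ v [T [x [hT hx]]].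
  destruct (hT Y) as [y _].
  assert (yf : y ∘ f = x) by exact (terminal_unique _ _ hT).
  apply (change_of_base_conservative PB yf HC Hcoh hx). }
assert (gs : forall (A X Y : C) (p : Hom A Y) (f : Hom X Y) (s : Hom Y A)
    (k : Pullback p f),
    p ∘ s = idm Y -> global_support X -> global_support (pb_ob k)).
{ intros A X Y p f s k ps.
  assert (e : p ∘ (s ∘ f) = f ∘ idm X) by (rewrite (precomp ps); cat).
  exact (global_support_of_hom PB (pb_lift k e)). }
split.
- split.
  + intros A X Y p f [s ps].
    exact (inhabits (GS_pullback
             (gs _ _ _ _ _ s (PB _ _ _ _ _) ps (proj2_sig X)))).
  + intros X Y f pb P Q u hu.
    pose (point := fun S : Point Y => @Build_Point C (proj1_sig Y)
      (proj1_sig (pt_ob S)) (pt_proj S) (pt_sect S) (pt_split S)).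
    pose (u' := @Build_PointHom C _ (point P) (point Q) (pt_map u)
                  (pt_map_proj u) (pt_map_sect u)).
    (* Pullbacks in [C] with the same objects and projections as those of
       [pb], so that [fmap (base_change pb) u] can serve for both. *)
    pose (k := fun S : Point Y => pullback_of_GS
       (gs _ _ _ _ _ _ (PB _ _ _ (pt_proj (point S)) f) (pt_split (point S))
          (proj2_sig X)) (pb S)).
    apply iso_pt.
    apply (cons _ _ f _ _ u' (k P) (k Q)
             (pt_map (fmap (base_change pb) u)) (proj2_sig X)).
    * apply (@pb_lift_fst (GS C)).
    * apply (@pb_lift_snd (GS C)).
    * exact (pt_iso hu).
- intros hgs; split.
  + intros A X Y p f _; exact (inhabits (PB _ _ _ p f)).
  + intros X Y f pb P Q u hu; apply iso_pt.
    apply (cons _ _ f _ _ u (pb P) (pb Q)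
             (pt_map (fmap (base_change pb) u)) (hgs X)).
    * apply pb_lift_fst.
    * apply pb_lift_snd.
    * exact (pt_iso hu).
Qed.
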